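(* Let $F$ be a field, let $X$ be a finite connected poset and let $x,y\in X$. Let $\epsilon,\eta\in I(X,F)$ be primitive idempotents such that $\epsilon_D=e_x$ and $\eta_D=e_y$. There exists a bijective linear map $\varphi:I(X,F)\to I(X,F)$ preserving products equal to $\epsilon$ and $\eta$ if and only if there exists an order automorphism of $X$ mapping $x$ to $y$. In this case, any such $\varphi$ is either an automorphism of the algebra $I(X,F)$ or the negative of an automorphism of the algebra $I(X,F)$.
   Context: The incidence algebra $I(X,F)$ of a finite poset $X$ over a field $F$ is the $F$-vector space with basis $\{e_{uv}\mid u\le v\}$ and multiplication $e_{uv}e_{wz}=e_{uz}$ if $v=w$ and $e_{uv}e_{wz}=0$ otherwise; it is a unital associative algebra. Write $e_u:=e_{uu}$ and $f=\sum_{u\le v}f(u,v)e_{uv}$ for $f\in I(X,F)$; the diagonal part of $f$ is $f_D:=\sum_{u\in X}f(u,u)e_u$. A poset $X$ is connected if for all $u,v\in X$ there is a sequence $u=x_0,x_1,\dots,x_m=v$ in $X$ such that for each $i$ one of $x_i,x_{i+1}$ covers the other. An order automorphism of a finite poset $X$ is an order-preserving bijection of $X$. An idempotent $e$ is primitive if $e=e_1+e_2$ with $e_1,e_2$ orthogonal idempotents ($e_1e_2=e_2e_1=0$) implies $e_1,e_2\in\{0,e\}$. A map $\varphi:A\to B$ between algebras preserves products equal to $a\in A$ and $b\in B$ if for all $a_1,a_2\in A$, $a_1a_2=a$ implies $\varphi(a_1)\varphi(a_2)=b$. *)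

(* Defs.v *)
From HB Require Import structures.
From mathcomp Require Import all_boot all_order all_algebra.
Set Implicit Arguments.
Unset Strict Implicit.
Unset Printing Implicit Defensive.
Import Order.TTheory GRing.Theory.
Local Open Scope ring_scope.

Section Posets.
Context {d : Order.disp_t} (X : finPOrderType d).

Definition covers (u v : X) : bool :=
  (u < v)%O && [forall w : X, ~~ ((u < w)%O && (w < v)%O)].

Definition connected_poset : Prop :=
  forall u v : X, connect (fun a b : X => covers a b || covers b a) u v.

(* As X is finite, the inverse of such a bijection also preserves the order. *)
Definition order_automorphism (s : X -> X) : Prop :=
  bijective s /\ {homo s : u v / (u <= v)%O}.

End Posets.

(* An element f = \sum_(u <= v) f(u,v) e_uv is encoded by its coordinates, a
   function on X * X that vanishes outside the order relation. *)
Section IncidenceAlgebra.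
Context (F : fieldType) {d : Order.disp_t} (X : finPOrderType d).

Definition incident : {pred {ffun X * X -> F^o}} :=
  fun f => [forall p : X * X, (f p != 0) ==> (p.1 <= p.2)%O].

Lemma incidentP (f : {ffun X * X -> F^o}) :
  reflect (forall u v, ~~ (u <= v)%O -> f (u, v) = 0) (f \in incident).
Proof.
apply: (iffP forallP) => [f_inc u v nuv | f_inc [u v]].
  by apply/eqP; apply: contraNT nuv; apply/implyP/(f_inc (u, v)).
by apply/implyP; apply: contraNT => /f_inc ->.
Qed.

Lemma incident_submod_closed : submod_closed incident.
Proof.
split=> [|a f g /incidentP f_inc /incidentP g_inc].
  by apply/incidentP => u v _; rewrite ffunE.
by apply/incidentP => u v nuv; rewrite !ffunE f_inc // g_inc // scaler0 addr0.
Qed.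

HB.instance Definition _ :=
  GRing.isSubmodClosed.Build F {ffun X * X -> F^o} incident incident_submod_closed.

Record incalg := IncAlg {
  incalg_ffun : {ffun X * X -> F^o};
  _ : incalg_ffun \in incident }.

HB.instance Definition _ := [isSub for incalg_ffun].
HB.instance Definition _ := [Choice of incalg by <:].
HB.instance Definition _ := [SubChoice_isSubLmodule of incalg by <:].

Definition coef (f : incalg) (u v : X) : F := val f (u, v).

Lemma coef_eq0 (f : incalg) u v : ~~ (u <= v)%O -> coef f u v = 0.
Proof. by move/(incidentP _ (valP f)). Qed.

Lemma incalgP (f g : incalg) : (forall u v, coef f u v = coef g u v) <-> f = g.
Proof.
split=> [fg | -> //].
by apply: val_inj; apply/ffunP => -[u v]; exact: fg.
Qed.

Lemma coef0 u v : coef 0 u v = 0.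
Proof. by rewrite /coef ffunE. Qed.

Lemma coefD f g u v : coef (f + g) u v = coef f u v + coef g u v.
Proof. by rewrite /coef ffunE. Qed.

Lemma coefN f u v : coef (- f) u v = - coef f u v.
Proof. by rewrite /coef ffunE. Qed.

Lemma coefZ a f u v : coef (a *: f) u v = a * coef f u v.
Proof. by rewrite /coef ffunE. Qed.

Lemma coef_sum (I : Type) (r : seq I) (P : pred I) (G : I -> incalg) u v :
  coef (\sum_(i <- r | P i) G i) u v = \sum_(i <- r | P i) coef (G i) u v.
Proof.
apply: (big_morph (fun f => coef f u v)) => [f g |]; first exact: coefD.
exact: coef0.
Qed.

Lemma e_subproof (a b : X) :
  [ffun p : X * X => ((a <= b)%O && (p == (a, b)))%:R : F^o] \in incident.
Proof.
apply/incidentP => u v nuv; rewrite ffunE.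
case: eqP => [[uE vE] | _]; last by rewrite andbF.
by rewrite -uE -vE (negPf nuv).
Qed.

(* Meant for a <= b; the value is 0 otherwise. *)
Definition e_ (a b : X) : incalg := IncAlg (e_subproof a b).

Lemma coef_e a b u v :
  (a <= b)%O -> coef (e_ a b) u v = ((u == a) && (v == b))%:R.
Proof. by move=> ab; rewrite /coef /= ffunE ab xpair_eqE. Qed.

Definition incalg_one : incalg := \sum_(u : X) e_ u u.

Lemma incalg_mul_subproof (f g : incalg) :
  [ffun p : X * X => \sum_(w : X) coef f p.1 w * coef g w p.2] \in incident.
Proof.
apply/incidentP => u v nuv; rewrite ffunE /= big1 // => w _.
have [uw | nuw] := boolP (u <= w)%O; last by rewrite coef_eq0 ?mul0r.
have [wv | nwv] := boolP (w <= v)%O; last by rewrite (coef_eq0 g) ?mulr0.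
by rewrite (le_trans uw wv) in nuv.
Qed.

Definition incalg_mul (f g : incalg) : incalg :=
  IncAlg (incalg_mul_subproof f g).

Lemma coef_one u v : coef incalg_one u v = (u == v)%:R.
Proof.
rewrite coef_sum (bigD1 u) //= coef_e // eqxx /= big1 ?addr0 1?eq_sym // => w wu.
by rewrite coef_e // eq_sym (negPf wu).
Qed.

Lemma coef_mul f g u v :
  coef (incalg_mul f g) u v = \sum_(w : X) coef f u w * coef g w v.
Proof. by rewrite {1}/coef /= ffunE. Qed.

Lemma incalg_mulA : associative incalg_mul.
Proof.
move=> f g h; apply/incalgP => u v; rewrite !coef_mul.
under eq_bigr => w _ do rewrite coef_mul mulr_sumr.
under [RHS]eq_bigr => w _ do rewrite coef_mul mulr_suml.
rewrite exchange_big /=; apply: eq_bigr => w _.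
by apply: eq_bigr => z _; rewrite mulrA.
Qed.

Lemma incalg_mul1l : left_id incalg_one incalg_mul.
Proof.
move=> f; apply/incalgP => u v; rewrite coef_mul (bigD1 u) //= coef_one eqxx.
rewrite mul1r big1 ?addr0 // => w wu.
by rewrite coef_one eq_sym (negPf wu) mul0r.
Qed.

Lemma incalg_mul1r : right_id incalg_one incalg_mul.
Proof.
move=> f; apply/incalgP => u v; rewrite coef_mul (bigD1 v) //= coef_one eqxx.
rewrite mulr1 big1 ?addr0 // => w wv.
by rewrite coef_one (negPf wv) mulr0.
Qed.

Lemma incalg_mulDl : left_distributive incalg_mul +%R.
Proof.
move=> f g h; apply/incalgP => u v; rewrite coefD !coef_mul -big_split /=.
by apply: eq_bigr => w _; rewrite coefD mulrDl.
Qed.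

Lemma incalg_mulDr : right_distributive incalg_mul +%R.
Proof.
move=> f g h; apply/incalgP => u v; rewrite coefD !coef_mul -big_split /=.
by apply: eq_bigr => w _; rewrite coefD mulrDr.
Qed.

(* Only a pzRingType: over the empty poset 1 = 0.  For the same reason incalg
   cannot be an algType (those are nonzero rings); compatibility with scalars is
   given by the lemmas incalg_scalerAl and incalg_scalerAr. *)
HB.instance Definition _ := GRing.Zmodule_isPzRing.Build incalg
  incalg_mulA incalg_mul1l incalg_mul1r incalg_mulDl incalg_mulDr.

Lemma coefM (f g : incalg) u v :
  coef (f * g) u v = \sum_(w : X) coef f u w * coef g w v.
Proof. exact: coef_mul. Qed.

Lemma incalg_scalerAl (a : F) (f g : incalg) : a *: (f * g) = (a *: f) * g.
Proof.
apply/incalgP => u v; rewrite coefZ !coefM mulr_sumr.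
by apply: eq_bigr => w _; rewrite coefZ mulrA.
Qed.

Lemma incalg_scalerAr (a : F) (f g : incalg) : a *: (f * g) = f * (a *: g).
Proof.
apply/incalgP => u v; rewrite coefZ !coefM mulr_sumr.
by apply: eq_bigr => w _; rewrite coefZ mulrCA.
Qed.

Lemma mul_e u v w z : (u <= v)%O -> (w <= z)%O ->
  e_ u v * e_ w z = if v == w then e_ u z else 0.
Proof.
move=> uv wz; apply/incalgP => a b; rewrite coefM (bigD1 v) //= big1 => [|t tv].
  rewrite addr0 !coef_e // eqxx andbT; have [vw | vw] := eqVneq v w.
    have uz : (u <= z)%O by rewrite (le_trans uv) // vw.
    by rewrite coef_e // -natrM mulnb.
  by rewrite coef0 mulr0.
by rewrite coef_e // (negPf tv) andbF mul0r.
Qed.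

Lemma incalg_sumE (f : incalg) :
  f = \sum_(u : X) \sum_(v : X | (u <= v)%O) coef f u v *: e_ u v.
Proof.
apply/incalgP => a b; rewrite coef_sum (bigD1 a) //= [X in _ + X]big1.
  rewrite addr0 coef_sum; have [ab | nab] := boolP (a <= b)%O.
    rewrite (bigD1 b) //= big1 => [|v /andP[av vb]].
      by rewrite addr0 coefZ coef_e // !eqxx mulr1.
    by rewrite coefZ coef_e // [b == v]eq_sym (negPf vb) andbF mulr0.
  rewrite coef_eq0 // big1 // => v av; rewrite coefZ coef_e // eqxx /=.
  case: eqP => [bv | _]; last by rewrite mulr0.
  by rewrite bv av in nab.
move=> u ua; rewrite coef_sum big1 // => v uv.
by rewrite coefZ coef_e // eq_sym (negPf ua) mulr0.
Qed.

Definition diag_part (f : incalg) : incalg :=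
  \sum_(u : X) coef f u u *: e_ u u.

Definition alg_automorphism (psi : incalg -> incalg) : Prop :=
  [/\ linear psi, monoid_morphism psi & bijective psi].

End IncidenceAlgebra.

Definition primitive_idempotent (A : pzRingType) (e : A) : Prop :=
  e * e = e /\
  forall e1 e2 : A,
    e1 * e1 = e1 -> e2 * e2 = e2 -> e1 * e2 = 0 -> e2 * e1 = 0 ->
    e = e1 + e2 -> (e1 = 0 \/ e1 = e) /\ (e2 = 0 \/ e2 = e).

Definition preserves_products_equal_to (A B : pzRingType)
    (phi : A -> B) (a : A) (b : B) : Prop :=
  forall a1 a2 : A, a1 * a2 = a -> phi a1 * phi a2 = b.

(* Main.v *)
Require Import Defs.
From HB Require Import structures.
From mathcomp Require Import all_boot all_order all_algebra.
Import Order.TTheory GRing.Theory.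
Local Open Scope ring_scope.
Set Implicit Arguments.
Unset Strict Implicit.

(** Conjugating by inner automorphisms, which exist because an idempotent with
    diagonal part [e_x] is conjugate to [e_x], one may assume that the two
    idempotents are the matrix units [e_x] and [e_y]. Write A for the incidence
    algebra, M = e_x A (1 - e_x), N = (1 - e_x) A e_x and
    B = (1 - e_x) A (1 - e_x), so that A = F e_x + M + N + B, and note M N = 0.
    The same Peirce decomposition of A with respect to [e_y] is written with
    primes.

    The hypothesis on phi is tested on factorizations of [e_x] close to
    e_x = e_x e_x: if e_x c + a e_x + a c = 0, then (e_x + a)(e_x + c) = e_x, and
    expanding phi (e_x + a) phi (e_x + c) = e_y gives a relation on phi
    ([pres_perturb]). No scalars are rescaled, so the argument is the same over
    every field, the two-element field included. Each choice of (a, c) gives a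
    relation valid in all rings; [pres_mul0], [pres_mul_idem],
    [pres_mul_upper], [pres_mul_upper0] and their mirror images are those that
    matter.

    Put p = phi e_x and h = phi (1 - e_x). A diagonal coefficient is a
    multiplicative functional. If the one of h at some z <> y were 0, the
    relations would force the coefficient at z of every value of phi to be 0,
    against surjectivity. Hence e_y + h, having no zero on its diagonal, is
    invertible, and this yields p = e_y or p = - e_y ([image_e_pm]). Up to
    replacing phi by its opposite, p = e_y; then phi 1 = e_y + h =: H is
    invertible.

    The elements e_y and phi(e_u) H^-1, for u <> x, are orthogonal nonzero
    idempotents indexed by X. The diagonal has as many positions as there are
    idempotents, so each of them has a single 1 on its diagonal and is
    conjugate to a matrix unit ([orth_idem_diag]); hence its corner is
    one-dimensional and has no zero divisors. Inside these corners the
    relations show that the image of M lies in M' and the image of N in N'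
    ([image_upper], [image_lower]), the only alternative being
    phi(e_xu) = phi(e_u). Now H commutes with the image of every matrix unit, so it is
    central; as X is connected, H is a scalar, and H e_y = e_y gives phi 1 = 1
    ([image1]). Multiplicativity is then checked on matrix units ([image_mul]);
    the products N M need a factorization of [e_x] into sums of several matrix
    units ([image_lower_upper]).

    Finally, an algebra automorphism sends the family of the e_u to orthogonal
    nonzero idempotents, whose diagonals define a permutation s of X. It
    preserves the order since e_u A e_v <> 0 exactly when u <= v
    ([alg_automorphism_order]). Conversely an order automorphism permutes the
    matrix units. *)

Lemma addr_eq_self (V : zmodType) (x y : V) : x + y = x -> y = 0.
Proof. by move=> xy; apply: (addrI x); rewrite xy addr0. Qed.

(** * Products equal to an idempotent, in arbitrary rings *)

Section ProductsEqualToIdempotent.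
Context {R S : pzRingType} (phi : {additive R -> S}) (e : R) (f : S).
Context (ee : e * e = e) (pres : preserves_products_equal_to phi e f).

Lemma pres_sq : phi e * phi e = f.
Proof. exact: pres. Qed.

(** The source of all the relations below: this is the expansion of
    phi (e + a) phi (e + c) = f, where (e + a)(e + c) = e. *)
Lemma pres_perturb a c :
  e * c + a * e + a * c = 0 ->
  phi e * phi c + phi a * phi e + phi a * phi c = 0.
Proof.
move=> ac0; have /pres : (e + a) * (e + c) = e.
  by rewrite mulrDl !mulrDr ee -addrA [e * c + _]addrA ac0 addr0.
rewrite !raddfD mulrDl !mulrDr pres_sq -addrA.
by move=> /addr_eq_self; rewrite addrA.
Qed.

Lemma pres_ann_l a : a * e = 0 -> phi a * phi e = 0.
Proof.
move=> ae; have := @pres_perturb a 0.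
by rewrite raddf0 !mulr0 ae !addr0 add0r => ->.
Qed.

Lemma pres_ann_r c : e * c = 0 -> phi e * phi c = 0.
Proof.
move=> ec; have := @pres_perturb 0 c.
by rewrite raddf0 !mul0r ec !addr0 => ->.
Qed.

Lemma pres_mul0 a c : a * e = 0 -> e * c = 0 -> a * c = 0 -> phi a * phi c = 0.
Proof.
move=> ae ec ac; have := @pres_perturb a c.
by rewrite ae ec ac !addr0 pres_ann_l // pres_ann_r // !add0r => ->.
Qed.

(** Both sides equal phi b phi (b c): subtract two instances of [pres_mul0], for
    the pairs (b, c - b c) and (1 - e - b, b c). *)
Lemma pres_mul_idem b c : b * b = b -> b * e = 0 -> e * b = 0 -> e * c = 0 ->
  phi b * phi c = phi (1 - e) * phi (b * c).
Proof.
move=> bb be eb ec.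
have /eqP : phi b * phi (c - b * c) = 0.
  by rewrite pres_mul0 // mulrBr ?mulrA ?eb ?bb ?ec ?mul0r subrr.
rewrite raddfB mulrBr subr_eq0 => /eqP ->.
have /eqP : phi (1 - e - b) * phi (b * c) = 0.
  rewrite pres_mul0 //; first by rewrite !mulrBl mul1r ee be subr0 subrr.
    by rewrite mulrA eb mul0r.
  by rewrite !mulrBl mul1r !mulrA bb eb mul0r subr0 subrr.
by rewrite [in X in X == 0]raddfB mulrBl subr_eq0 => /eqP ->.
Qed.

(** Here b and 1 - e - b annihilate each other, and so do their images. *)
Lemma pres_mul_idem_comm b : b * b = b -> b * e = 0 -> e * b = 0 ->
  phi b * phi (1 - e) = phi b * phi b /\ phi (1 - e) * phi b = phi b * phi b.
Proof.
move=> bb be eb; split; apply/eqP.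
  rewrite -subr_eq0 -mulrBr -raddfB pres_mul0 // !mulrBr mulr1 ?ee ?eb ?be ?bb.
    by rewrite subrr subr0.
  by rewrite subr0 subrr.
rewrite -subr_eq0 -mulrBl -raddfB pres_mul0 // !mulrBl mul1r ?ee ?eb ?be ?bb.
  by rewrite subrr subr0.
by rewrite subr0 subrr.
Qed.

Section UpperPart.
Context (m g : R) (em : e * m = m) (me : m * e = 0) (eg : e * g = 0).

Let mm : m * m = 0.
Proof. by rewrite -[in X in _ * X]em mulrA me mul0r. Qed.

(** Perturb by (m, g - m g): as m m = 0, the second factor of
    (e + m)(e - m g + g) = e absorbs the effect of m. *)
Lemma pres_mul_upper : phi m * phi g = (phi e + phi m) * phi (m * g).
Proof.
have /pres_perturb : e * (g - m * g) + m * e + m * (g - m * g) = 0.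
  by rewrite me !mulrBr eg !mulrA em mm mul0r sub0r subr0 addr0 addNr.
rewrite raddfB !mulrBr pres_ann_r // pres_ann_l // sub0r addr0 mulrDl.
by rewrite addrCA -opprD => /eqP; rewrite subr_eq0 => /eqP.
Qed.

(** Adding to m an element b that kills g gives one more factorization of e,
    (e + m + b)(e - m g + g); comparing it with that of [pres_mul_upper]
    isolates phi b phi (m g). *)
Lemma pres_mul_upper0 b : b * e = 0 -> b * g = 0 -> phi b * phi (m * g) = 0.
Proof.
move=> be bg; have bm : b * m = 0 by rewrite -em mulrA be mul0r.
have /pres_perturb :
    e * (g - m * g) + (m + b) * e + (m + b) * (g - m * g) = 0.
  rewrite !mulrBr !mulrDl !mulrA me be eg em mm bm bg !mul0r.
  by rewrite !addr0 sub0r subr0 addNr.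
rewrite raddfB raddfD !mulrBr !mulrDl (pres_ann_r eg).
rewrite (pres_ann_l me) (pres_ann_l be) (pres_mul0 be eg bg).
rewrite pres_mul_upper mulrDl sub0r !addr0 opprD [X in _ + X]addrA addrK addrA
  addNr sub0r.
by move/eqP; rewrite oppr_eq0 => /eqP.
Qed.
End UpperPart.

(** Mirror images of the previous two lemmas, with (1 - e) R e in place of e R
    (1 - e). *)
Section LowerPart.
Context (n g : R) (ne : n * e = n) (en : e * n = 0) (ge : g * e = 0).

Let nn : n * n = 0.
Proof. by rewrite -[in X in X * _]ne -mulrA en mulr0. Qed.

Lemma pres_mul_lower : phi g * phi n = phi (g * n) * (phi e + phi n).
Proof.
have /pres_perturb : e * n + (g - g * n) * e + (g - g * n) * n = 0.
  by rewrite en !mulrBl ge -!mulrA ne nn mulr0 sub0r subr0 add0r addNr.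
rewrite raddfB !mulrBl pres_ann_r // pres_ann_l // sub0r add0r mulrDr.
by rewrite addrCA -opprD => /eqP; rewrite subr_eq0 => /eqP.
Qed.

Lemma pres_mul_lower0 b : e * b = 0 -> g * b = 0 -> phi (g * n) * phi b = 0.
Proof.
move=> eb gb; have nb : n * b = 0 by rewrite -ne -mulrA eb mulr0.
have /pres_perturb :
    e * (n + b) + (g - g * n) * e + (g - g * n) * (n + b) = 0.
  rewrite !mulrBl !mulrDr -!mulrA en eb ge ne nn nb gb !mulr0.
  by rewrite !addr0 add0r sub0r subr0 addNr.
rewrite raddfB raddfD !mulrBl !mulrDr (pres_ann_l ge).
rewrite (pres_ann_r en) (pres_ann_r eb) (pres_mul0 ge eb gb).
rewrite pres_mul_lower mulrDr sub0r !addr0 add0r opprD [X in _ + X]addrA addrK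
  addrA addNr sub0r.
by move/eqP; rewrite oppr_eq0 => /eqP.
Qed.
End LowerPart.

End ProductsEqualToIdempotent.

(** * Corners without zero divisors *)

Definition corner_domain {S : pzRingType} (q : S) : Prop :=
  forall a b : S, q * a * q = a -> q * b * q = b -> a * b = 0 -> a = 0 \/ b = 0.

Section Corner.
Context {S : pzRingType} (f q t : S) (ff : f * f = f).
Context (qq : q * q = q) (fq : f * q = 0) (qf : q * f = 0).
Context (q_domain : corner_domain q) (qtq : q * t * q = t).

(** In the application f = e_y, and q is the idempotent attached to u, t lies in
    its corner, a is the image of the matrix unit e_xu.  The component q a of a
    satisfies (q a)(t - q a) = 0, so it is 0 or t; in the second case the
    component f a vanishes. *)
Lemma corner_upper a : a * q = a -> (f + q) * a = a ->
  a * t = (f + a) * a -> a = t \/ q * a = 0.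
Proof.
move=> aq fqa ata.
have qaE : q * (q * a) * q = q * a by rewrite !mulrA qq -mulrA aq.
have aqa : a * a = a * (q * a) by rewrite mulrA aq.
have : q * a * (t - q * a) = 0.
  have : q * (a * t) = q * ((f + a) * a) by rewrite ata.
  rewrite mulrA mulrDl aqa mulrDr [q * (f * a)]mulrA qf mul0r add0r => qat.
  by rewrite mulrBr qat !mulrA subrr.
have qtaE : q * (t - q * a) * q = t - q * a by rewrite mulrBr mulrBl qtq qaE.
move=> /(q_domain qaE qtaE) [qa0 | /eqP]; first by right.
rewrite subr_eq0 => /eqP tqa; left.
have fa0 : f * a = 0.
  have : f * (a * t) = f * ((f + a) * a) by rewrite ata.
  rewrite mulrDl aqa -tqa mulrDr [f * (f * a)]mulrA ff => /esym;
    rewrite addrC; exact: addr_eq_self.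
by rewrite tqa -{1}fqa mulrDl fa0 add0r.
Qed.

Lemma corner_lower a : q * a = a -> a * (f + q) = a ->
  t * a = a * (f + a) -> a = t \/ a * q = 0.
Proof.
move=> qa afq taa.
have aqE : q * (a * q) * q = a * q by rewrite -!mulrA qq mulrA qa.
have aqa : a * a = a * q * a by rewrite -mulrA qa.
have : (t - a * q) * (a * q) = 0.
  have : (t * a) * q = (a * (f + a)) * q by rewrite taa.
  rewrite mulrDr aqa mulrDl -[a * f * q]mulrA fq mulr0 add0r => taq.
  by rewrite mulrBl mulrA taq !mulrA subrr.
have qtaE : q * (t - a * q) * q = t - a * q by rewrite mulrBr mulrBl qtq aqE.
move=> /(q_domain qtaE aqE) [/eqP | aq0]; last by right.
rewrite subr_eq0 => /eqP taq; left.
have af0 : a * f = 0.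
  have : (t * a) * f = (a * (f + a)) * f by rewrite taa.
  rewrite mulrDr aqa -taq mulrDl -[a * f * f]mulrA ff => /esym; rewrite addrC;
    exact: addr_eq_self.
by rewrite taq -{1}afq mulrDr af0 add0r.
Qed.

End Corner.

(** * The incidence algebra: diagonal, invertibility, idempotents, centre *)

(** The standard intertwiner of two idempotents.  It conjugates them when it is
    invertible, for instance when they agree modulo a nilpotent ideal. *)
Lemma idem_intertwine (R : pzRingType) (f g : R) : f * f = f -> g * g = g ->
  f * (f * g + (1 - f) * (1 - g)) = (f * g + (1 - f) * (1 - g)) * g.
Proof.
move=> ff gg.
have f1f : f * (1 - f) = 0 by rewrite mulrBr mulr1 ff subrr.
have g1g : (1 - g) * g = 0 by rewrite mulrBl mul1r gg subrr.
rewrite mulrDr [RHS]mulrDl [f * (f * g)]mulrA ff [f * (_ * _)]mulrA f1f mul0r.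
by rewrite -!mulrA gg g1g mulr0.
Qed.

Section IncidenceAlgebraTheory.
Context {F : fieldType} {d : Order.disp_t} {X : finPOrderType d}.
Local Notation A := (incalg F X).
Local Notation e := (e_ F).
Implicit Types (f g : A) (u v w z : X).

Lemma incalg_span_ind (P : A -> Prop) :
  P 0 -> (forall f g, P f -> P g -> P (f + g)) ->
  (forall a u v, (u <= v)%O -> P (a *: e u v)) -> forall f, P f.
Proof.
move=> P0 PD Pe f; rewrite [f]incalg_sumE.
by apply: big_ind => // u _; apply: big_ind => // v uv; apply: Pe.
Qed.

Lemma coef_e_mul u f v w : coef (e u u * f) v w = (v == u)%:R * coef f v w.
Proof.
rewrite Defs.coefM (bigD1 v) //= big1 => [|t tv].
  by rewrite coef_e // addr0; case: eqP => [->|]; rewrite ?eqxx.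
rewrite coef_e //; case: eqP => [vu|]; last by rewrite mul0r.
by rewrite -vu (negPf tv) mul0r.
Qed.

Lemma coef_mul_e u f v w : coef (f * e u u) v w = coef f v w * (w == u)%:R.
Proof.
rewrite Defs.coefM (bigD1 w) //= big1 => [|t tw].
  by rewrite coef_e // addr0 andbb.
rewrite coef_e //; have [tu | //] := eqVneq t u; last by rewrite mulr0.
by rewrite -tu eq_sym (negPf tw) mulr0.
Qed.

Lemma e_mul_mul_e u f v : e u u * f * e v v = coef f u v *: e u v.
Proof.
apply/incalgP => a b; rewrite coef_mul_e coef_e_mul Defs.coefZ.
have [uv | nuv] := boolP (u <= v)%O; last first.
  rewrite (coef_eq0 f nuv) mul0r.
  by do 2?case: eqP => [->|_]; rewrite ?mul0r ?mulr0 // coef_eq0 ?mulr0 ?mul0r.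
rewrite coef_e //.
by do 2?case: eqP => [->|_]; rewrite ?mul0r ?mulr0 ?mulr1 ?mul1r.
Qed.

Lemma e_idem u : e u u * e u u = e u u.
Proof. by rewrite mul_e // eqxx. Qed.

Lemma mul_e_l u v : (u <= v)%O -> e u u * e u v = e u v.
Proof. by move=> uv; rewrite mul_e // eqxx. Qed.

Lemma mul_e_r u v : (u <= v)%O -> e u v * e v v = e u v.
Proof. by move=> uv; rewrite mul_e // eqxx. Qed.

Lemma mul_e_neq u v w z : (u <= v)%O -> (w <= z)%O -> v != w ->
  e u v * e w z = 0.
Proof. by move=> uv wz /negPf vw; rewrite mul_e // vw. Qed.

Lemma e_neq0 u v : (u <= v)%O -> e u v != 0.
Proof.
move=> uv; apply/eqP => /(congr1 (fun f => coef f u v)) /eqP.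
by rewrite coef_e // !eqxx Defs.coef0 oner_eq0.
Qed.

Lemma coefM_diag f g z : coef (f * g) z z = coef f z z * coef g z z.
Proof.
rewrite Defs.coefM (bigD1 z) //= big1 ?addr0 // => w wz.
have [zw | nzw] := boolP (z <= w)%O; last by rewrite coef_eq0 ?mul0r.
rewrite (coef_eq0 g) ?mulr0 //; apply: contra wz => wz.
by rewrite eq_le wz zw.
Qed.

Lemma coef_diag_part f u v : coef (diag_part f) u v = coef f u u * (u == v)%:R.
Proof.
rewrite Defs.coef_sum (bigD1 u) //= big1 => [|w wu].
  by rewrite Defs.coefZ coef_e // eqxx addr0 eq_sym.
by rewrite Defs.coefZ coef_e // eq_sym (negPf wu) mulr0.
Qed.

Lemma coef1E u v : coef (1 : A) u v = (u == v)%:R.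
Proof. exact: coef_one. Qed.

(** A nonzero coefficient of the k-th power of n lives on a chain of length k,
    along which the size of the principal down-sets strictly increases. *)
Lemma expr_diag0_eq0 (n : A) :
  (forall u, coef n u u = 0) -> n ^+ #|X|.+1 = 0.
Proof.
move=> n0; pose rank u := #|[set w : X | (w <= u)%O]|.
have rank_lt u v : (u < v)%O -> (rank u < rank v)%N.
  move=> uv; apply: proper_card; apply/properP; split.
    by apply/subsetP => w; rewrite !inE => /le_trans; apply; apply: ltW.
  by exists v; rewrite inE ?lexx ?(lt_geF uv).
have n_rank k u v : coef (n ^+ k) u v != 0 -> (k + rank u <= rank v)%N.
  elim: k u v => [|k IH] u v.
    by rewrite expr0 coef1E; have [->|_] := eqVneq u v; rewrite ?eqxx.
  rewrite exprS Defs.coefM; apply: contraNT => lt_rank.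
  rewrite big1 // => w _; have [uw | nuw] := boolP (u < w)%O; last first.
    have [uw | nuw'] := boolP (u <= w)%O; last by rewrite coef_eq0 ?mul0r.
    by move: nuw; rewrite lt_neqAle uw andbT negbK => /eqP ->; rewrite n0 mul0r.
  have [-> | /IH] := eqVneq (coef (n ^+ k) w v) 0; first by rewrite mulr0.
  move=> le_rank; case/negP: lt_rank; apply: leq_trans le_rank.
  by rewrite addSnnS leq_add2l rank_lt.
apply/incalgP => u v; rewrite Defs.coef0; apply/eqP;
  apply/negPn/negP => /n_rank.
apply/negP; rewrite -ltnNge addSn ltnS; apply: (leq_trans (max_card _)).
exact: leq_addr.
Qed.

(** After multiplication by an invertible diagonal matrix, on either side, the
    element becomes unipotent and is inverted by a geometric series. *)
Lemma diag_neq0_invertible f :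
  (forall u, coef f u u != 0) -> exists g, f * g = 1 /\ g * f = 1.
Proof.
move=> f_diag; pose D := \sum_u (coef f u u)^-1 *: e u u : A.
have coefD u v : coef D u v = (coef f u u)^-1 * (u == v)%:R.
  rewrite Defs.coef_sum (bigD1 u) //= big1 => [|w wu].
    by rewrite Defs.coefZ coef_e // eqxx addr0 eq_sym.
  by rewrite Defs.coefZ coef_e // eq_sym (negPf wu) mulr0.
have inv_unip (n : A) : (forall u, coef n u u = 1) ->
    exists g, n * g = 1 /\ g * n = 1.
  move=> n1; pose k := 1 - n.
  have /expr_diag0_eq0 k0 : forall u, coef k u u = 0.
    by move=> u; rewrite Defs.coefD Defs.coefN coef1E eqxx n1 subrr.
  have nE : n = 1 - k by rewrite opprB addrC subrK.
  pose g := \sum_(i < #|X|.+1) k ^+ i.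
  have comm_kg : k * g = g * k.
    by rewrite mulr_sumr mulr_suml; apply: eq_bigr => i _;
      rewrite -exprS -exprSr.
  have ng : n * g = 1.
    by apply: oppr_inj; rewrite nE -mulNr opprB -subrX1 k0 sub0r.
  exists g; split=> //.
  by rewrite -ng nE mulrBl mulrBr comm_kg mulr1 mul1r.
have Df u : coef D u u * coef f u u = 1.
  by rewrite coefD eqxx mulr1 mulVf.
have [g [_ gDf]] : exists g, (D * f) * g = 1 /\ g * (D * f) = 1.
  by apply: inv_unip => u; rewrite coefM_diag.
have [g' [fDg _]] : exists g, (f * D) * g = 1 /\ g * (f * D) = 1.
  by apply: inv_unip => u; rewrite coefM_diag mulrC.
have eqg : D * g' = g * D.
  by rewrite -[D * g']mul1r -gDf -!mulrA [f * _]mulrA fDg mulr1.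
exists (D * g'); split; first by rewrite mulrA.
by rewrite eqg -mulrA.
Qed.

Lemma idem_diag f z : f * f = f -> coef f z z = 0 \/ coef f z z = 1.
Proof.
move=> ff; have /eqP : coef f z z * (coef f z z - 1) = 0.
  by rewrite mulrBr mulr1 -coefM_diag ff subrr.
rewrite mulf_eq0 subr_eq0 => /orP[] /eqP; by [left | right].
Qed.

(** 1 - f is invertible and f (1 - f) = 0. *)
Lemma idem_diag0_eq0 f : f * f = f -> (forall z, coef f z z = 0) -> f = 0.
Proof.
move=> ff f0; have [g [fg _]] : exists g, (1 - f) * g = 1 /\ g * (1 - f) = 1.
  apply: diag_neq0_invertible => u.
  by rewrite Defs.coefD Defs.coefN f0 coef1E eqxx subr0 oner_neq0.
by rewrite -[f]mulr1 -fg mulrA mulrBr mulr1 ff subrr mul0r.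
Qed.

(** The intertwiner of f and [e_s] has only ones on its diagonal. *)
Lemma idem_conj_e f s : f * f = f -> (forall z, coef f z z = (z == s)%:R) ->
  exists c c', [/\ c * c' = 1, c' * c = 1 & f = c * e s s * c'].
Proof.
move=> ff f_diag; pose c := f * e s s + (1 - f) * (1 - e s s).
have fc : f * c = c * e s s.
  exact/idem_intertwine/e_idem.
have [c' [cc' c'c]] : exists c', c * c' = 1 /\ c' * c = 1.
  apply: diag_neq0_invertible => u.
  rewrite Defs.coefD !coefM_diag !Defs.coefD !Defs.coefN !coef1E f_diag coef_e
    //.
  by case: (u == s); rewrite eqxx /= ?subrr ?subr0 ?mulr0 ?mulr1 ?addr0 ?add0r
    oner_neq0.
by exists c, c'; split=> //; rewrite -fc -mulrA cc' mulr1.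
Qed.

(** By conjugation to [e_s], the corner of f consists of the multiples of f. *)
Lemma corner_domain_idem f s :
  f * f = f -> (forall z, coef f z z = (z == s)%:R) -> corner_domain f.
Proof.
move=> ff f_diag a b faf fbf ab0.
have [c [c' [cc' c'c fE]]] := idem_conj_e ff f_diag.
have corner g : f * g * f = coef (c' * g * c) s s *: f.
  have -> : f * g * f = c * (e s s * (c' * g * c) * e s s) * c'.
    by rewrite fE !mulrA.
  by rewrite e_mul_mul_e -incalg_scalerAr -incalg_scalerAl -fE.
move: ab0; rewrite -faf -fbf !corner -incalg_scalerAl -incalg_scalerAr ff
  scalerA.
move/eqP; rewrite scaler_eq0 mulf_eq0.
by case/orP => [/orP[]|] /eqP ->; rewrite ?scale0r ?scaler0; [left|right|left].
Qed.

(** Each q u has a 1 somewhere on its diagonal, and orthogonality prevents two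
    of them from sharing a position; as there are as many idempotents as
    positions, each gets exactly one. *)
Lemma orth_idem_diag (q : X -> A) :
  (forall u v, q u * q v = if u == v then q u else 0) ->
  (forall u, q u != 0) ->
  exists s : X -> X, bijective s /\
    forall u z, coef (q u) z z = (z == s u)%:R.
Proof.
move=> q_orth q_neq0.
have q_idem u : q u * q u = q u by rewrite q_orth eqxx.
have /all_sig[s sP] u : {z | coef (q u) z z == 1}.
  apply: sigW; apply/existsP; apply: contraT; rewrite negb_exists =>
    /forallP no_one.
  have := q_neq0 u; rewrite (idem_diag0_eq0 (f := q u)) ?eqxx // => z.
  by have := no_one z; have [-> //|->] := idem_diag z (q_idem u); rewrite eqxx.
have q_disj u v z : coef (q u) z z = 1 -> coef (q v) z z = 1 -> u = v.
  move=> qu qv; apply/eqP; apply: contraT => uv.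
  have := coefM_diag (q u) (q v) z; rewrite q_orth (negPf uv) Defs.coef0 qu qv
    mulr1.
  by move/eqP; rewrite eq_sym oner_eq0.
have s_inj : injective s.
  by move=> u v suv; apply: (q_disj u v (s u)); [|rewrite suv]; apply/eqP/sP.
have s_bij := injF_bij s_inj.
exists s; split=> // u z; have [->|zu] := eqVneq z (s u); first exact/eqP.
have [// | qz] := idem_diag z (q_idem u).
case: s_bij => t _ ts; case/eqP: zu; rewrite -(ts z); congr s.
by have /eqP qz' := sP (t z); rewrite ts in qz'; apply: q_disj qz' qz.
Qed.

(** Commuting with the diagonal units makes f diagonal, and commuting with e_uv
    equates its diagonal entries at u and v; connectedness propagates this
    equality to all of X. *)
Lemma central_coef f y : connected_poset X ->
  (forall u v, (u <= v)%O -> f * e u v = e u v * f) ->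
  f = coef f y y *: (1 : A).
Proof.
move=> X_conn f_comm.
have f_diag u v : u != v -> coef f u v = 0.
  move=> uv; have := congr1 (fun g => coef g u v) (f_comm u u (lexx u)).
  by rewrite /= coef_mul_e coef_e_mul eqxx mul1r eq_sym (negPf uv) mulr0.
have f_le u v : (u <= v)%O -> coef f u u = coef f v v.
  move=> uv; have := congr1 (fun g => e u u * g * e v v) (f_comm u v uv).
  rewrite /= !mulrA mul_e // eqxx -[_ * e u v * _]mulrA mul_e // eqxx.
  have -> : e u u * f * e u v = e u u * f * e u u * e u v.
    by rewrite -[in RHS]mulrA mul_e // eqxx.
  have -> : e u v * f * e v v = e u v * (e v v * f * e v v).
    by rewrite !mulrA mul_e // eqxx.
  rewrite !e_mul_mul_e -incalg_scalerAl -incalg_scalerAr !mul_e // !eqxx.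
  move/(congr1 (fun g => coef g u v)).
  by rewrite /= !Defs.coefZ coef_e // !eqxx !mulr1.
have f_const u : coef f y y = coef f u u.
  have /connectP[p + ->] := X_conn y u.
  elim: p {u}y => //= w p IH a /andP[aw /IH <-].
  by case/orP: aw => /andP[/ltW/f_le -> _].
apply/incalgP => u v; rewrite Defs.coefZ coef1E.
have [<-|uv] := eqVneq u v; first by rewrite mulr1.
by rewrite f_diag // mulr0.
Qed.

End IncidenceAlgebraTheory.

(** * Bijections preserving products equal to diagonal matrix units *)

Section MatrixUnits.
Context {F : fieldType} {d : Order.disp_t} {X : finPOrderType d}.
Local Notation A := (incalg F X).
Local Notation e := (e_ F).
Context (phi : {linear A -> A}) (x y : X).
Context (phi_bij : bijective phi).
Context (pres : preserves_products_equal_to phi (e x x) (e y y)).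
Implicit Types (f g : A) (a b c u v w z : X).

Let ex : e x x * e x x = e x x := e_idem x.

Lemma e_split_idem a b : (a <= b)%O -> a != b ->
  (e a b + e b b) * (e a b + e b b) = e a b + e b b.
Proof.
move=> ab aDb; rewrite mulrDl !mulrDr !mul_e // eqxx.
by rewrite eq_sym (negPf aDb) !add0r.
Qed.

(** The corner B is spanned by the idempotents e_b and e_ab + e_b, which are the
    elements that [pres_mul_idem] and [pres_mul_idem_comm] handle. *)
Lemma off_idem_ind (P : A -> Prop) :
  (forall f g : A, P f -> P g -> P (f - g)) ->
  (forall f : A, f * f = f -> f * e x x = 0 -> e x x * f = 0 -> P f) ->
  forall a b, (a <= b)%O -> a != x -> b != x -> P (e a b).
Proof.
move=> PB Pidem a b ab ax bx; have xa : x != a by rewrite eq_sym.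
have xb : x != b by rewrite eq_sym.
have Pb : P (e b b) by apply: Pidem; rewrite ?e_idem ?mul_e_neq.
have [-> // | aDb] := eqVneq a b.
rewrite -[e a b](addrK (e b b)); apply: PB => //; apply: Pidem.
- exact: e_split_idem.
- by rewrite mulrDl !mul_e_neq // addr0.
- by rewrite mulrDr !mul_e_neq // addr0.
Qed.

(** Let t denote the diagonal coefficient at z, a multiplicative functional, and
    suppose t h = 0.  Then t p = 0 since p p = e_y.  The relations read
    (t b)(t h) = (t b)(t b) for the images of idempotents b of B, and
    (t m)(t h) = (t p + t m)(t m) for the images of elements of M, with a mirror
    image for N.  Hence t vanishes on the whole image of phi, which contains
    1. *)
Lemma diag_compl_neq0 z : z != y -> coef (phi (1 - e x x)) z z != 0.
Proof.
move=> zy; apply/eqP => h0.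
have sq0 (k : F) : k * k = 0 -> k = 0.
  by move/eqP; rewrite mulf_eq0 orbb => /eqP.
have p0 : coef (phi (e x x)) z z = 0.
  by apply: sq0; rewrite -coefM_diag (pres_sq ex pres) coef_e // (negPf zy).
have phi_e a b : (a <= b)%O -> coef (phi (e a b)) z z = 0.
  move=> ab; have [ax | ax] := eqVneq a x; have [bx | bx] := eqVneq b x.
  - by rewrite ax bx.
  - rewrite ax in ab *; apply: sq0.
    have := pres_mul_upper ex pres (mul_e_l ab) (mul_e_neq ab (lexx x) bx)
              (g := 1 - e x x).
    rewrite !mulrBr !mulr1 ex subrr mul_e_neq // subr0.
    move=> /(_ erefl)/(congr1 (fun g => coef g z z)).
    by rewrite /= mulrDl Defs.coefD !coefM_diag h0 p0 mulr0 mul0r add0r.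
  - rewrite bx in ab *; apply: sq0; have xa : x != a by rewrite eq_sym.
    have := pres_mul_lower ex pres (mul_e_r ab) _ (g := 1 - e x x).
    rewrite mul_e_neq // !mulrBl !mul1r ex subrr mul_e_neq // subr0.
    move=> /(_ erefl erefl)/(congr1 (fun g => coef g z z)).
    by rewrite /= mulrDr Defs.coefD !coefM_diag h0 p0 mulr0 mul0r add0r.
  - move: a b ab ax bx;
    apply: (off_idem_ind (P := fun f => coef (phi f) z z = 0)) =>
      [f g f0 g0 | f ff fx xf].
      by rewrite raddfB Defs.coefD Defs.coefN f0 g0 subr0.
    apply: sq0; rewrite -coefM_diag.
    have [<- _] := pres_mul_idem_comm ex pres ff fx xf.
    by rewrite coefM_diag h0 mulr0.
have phi0 f : coef (phi f) z z = 0.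
  move: f; apply: incalg_span_ind => [|f g f0 g0 |a u v uv].
  - by rewrite raddf0 Defs.coef0.
  - by rewrite raddfD Defs.coefD f0 g0 addr0.
  - by rewrite linearZ Defs.coefZ phi_e // mulr0.
have [phi' _ phi'K] := phi_bij; have /eqP := phi0 (phi' 1).
by rewrite phi'K coef1E eqxx oner_eq0.
Qed.

Lemma compl_orth : e y y * phi (1 - e x x) = 0 /\ phi (1 - e x x) * e y y = 0.
Proof.
have [xh hx] : e x x * (1 - e x x) = 0 /\ (1 - e x x) * e x x = 0.
  by rewrite mulrBr mulrBl mulr1 mul1r ex subrr.
rewrite -(pres_sq ex pres) -mulrA (pres_ann_r ex pres xh) mulr0; split=> //.
by rewrite mulrA (pres_ann_l ex pres hx) mul0r.
Qed.

(** At y the diagonal entry is 1, because e_y h = 0. *)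
Lemma unit_image_invertible :
  exists g, (e y y + phi (1 - e x x)) * g = 1 /\
            g * (e y y + phi (1 - e x x)) = 1.
Proof.
apply: diag_neq0_invertible => z; rewrite Defs.coefD coef_e // andbb.
have [-> | zy] := eqVneq z y; last by rewrite add0r diag_compl_neq0.
have := congr1 (fun f => coef f y y) (proj1 compl_orth).
rewrite /= coefM_diag coef_e // eqxx mul1r Defs.coef0 => ->.
by rewrite addr0 oner_neq0.
Qed.

(** As p h = 0, right multiplication by e_y + h does not distinguish p from
    p e_y.  Hence p = e_y p e_y is a multiple of e_y whose square is e_y. *)
Lemma image_e_pm : phi (e x x) = e y y \/ phi (e x x) = - e y y.
Proof.
have [g [Hg _]] := unit_image_invertible; have [yh _] := compl_orth.
have pp := pres_sq ex pres; set p := phi (e x x) in pp *.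
have ph : p * phi (1 - e x x) = 0.
  by apply: (pres_ann_r ex pres); rewrite mulrBr mulr1 ex subrr.
have pf : p = p * e y y.
  rewrite -[LHS]mulr1 -[RHS]mulr1 -Hg ![in LHS]mulrA ![in RHS]mulrA.
  congr (_ * g); rewrite !mulrDr ph -![p * e y y * _]mulrA e_idem yh mulr0.
  by [].
have fp : e y y * p = p by rewrite {2}pf -pp mulrA.
have := e_mul_mul_e y p y; rewrite fp -pf; set c := coef p y y => pE.
have : c ^+ 2 == 1.
  have := congr1 (fun f => coef f y y) pp.
  by rewrite /= coefM_diag coef_e // eqxx -/c -expr2 => ->.
by rewrite sqrf_eq1 pE => /orP[] /eqP ->; rewrite ?scale1r ?scaleN1r;
  [left | right].
Qed.

End MatrixUnits.

(** * Multiplicativity when one matrix unit is sent to the other *)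

Section MatrixUnitsNormalized.
Context {F : fieldType} {d : Order.disp_t} {X : finPOrderType d}.
Local Notation A := (incalg F X).
Local Notation e := (e_ F).
Context (phi : {linear A -> A}) (x y : X).
Context (X_connected : connected_poset X) (phi_bij : bijective phi).
Context (pres : preserves_products_equal_to phi (e x x) (e y y)).
Context (phi_ex : phi (e x x) = e y y).
Implicit Types (f g : A) (a b c u v w z : X).

Let ex : e x x * e x x = e x x := e_idem x.
Let ey : e y y * e y y = e y y := e_idem y.
Let h := phi (1 - e x x).
Let yh : e y y * h = 0. Proof. by have [] := compl_orth pres. Qed.
Let hy : h * e y y = 0. Proof. by have [] := compl_orth pres. Qed.

Let phi1 : phi 1 = e y y + h.
Proof. by rewrite -phi_ex -raddfD addrC subrK. Qed.

Let off_r f : e x x * f = 0 -> e y y * phi f = 0.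
Proof. by move=> xf; rewrite -phi_ex (pres_ann_r ex pres). Qed.

Let off_l f : f * e x x = 0 -> phi f * e y y = 0.
Proof. by move=> fx; rewrite -phi_ex (pres_ann_l ex pres). Qed.

Let phi_inj : injective phi := bij_inj phi_bij.

(** Throughout this section g is the inverse of phi 1 = e_y + h. *)
Section ImageCorners.
Context (g : A) (Hg : (e y y + h) * g = 1) (gH : g * (e y y + h) = 1).

Section Corner.
Context (u : X) (ux : u != x).
Let xu : x != u. Proof. by rewrite eq_sym. Qed.
Let r := 1 - e x x - e u u.
Let t := phi (e u u).
Let q := t * g.

Let h_split : h = t + phi r.
Proof. by rewrite /t -raddfD [in RHS]addrC subrK. Qed.

Let xr : e x x * r = 0.
Proof. by rewrite /r !mulrBr mulr1 ex mul_e_neq // subrr subr0. Qed.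
Let rx : r * e x x = 0.
Proof. by rewrite /r !mulrBl mul1r ex mul_e_neq // subrr subr0. Qed.
Let ur : e u u * r = 0.
Proof. by rewrite /r !mulrBr mulr1 e_idem mul_e_neq // subr0 subrr. Qed.
Let ru : r * e u u = 0.
Proof. by rewrite /r !mulrBl mul1r e_idem mul_e_neq // subr0 subrr. Qed.

Let ex_eu : e x x * e u u = 0. Proof. by rewrite mul_e_neq. Qed.
Let eu_ex : e u u * e x x = 0. Proof. by rewrite mul_e_neq. Qed.

Let th : t * h = t * t /\ h * t = t * t.
Proof. by apply: (pres_mul_idem_comm ex pres); rewrite ?e_idem ?mul_e_neq. Qed.
Let yt : e y y * t = 0. Proof. by rewrite off_r ?mul_e_neq. Qed.
Let ty : t * e y y = 0. Proof. by rewrite off_l ?mul_e_neq. Qed.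
Let ttg : t * t * g = t.
Proof.
by rewrite -(proj1 th) -[t * h]add0r -ty -mulrDr -mulrA Hg mulr1.
Qed.
Let gtt : g * (t * t) = t.
Proof.
by rewrite -(proj2 th) -[h * t]add0r -yt -mulrDl mulrA gH mul1r.
Qed.
Let gt : g * t = t * g.
Proof. by rewrite -[t in LHS]ttg mulrA gtt. Qed.
Let gy : g * e y y = e y y.
Proof.
by rewrite -[in LHS]ey -[X in g * X]addr0 -hy -mulrDl mulrA gH mul1r.
Qed.
Let yg : e y y * g = e y y.
Proof.
by rewrite -[in LHS]ey -[X in X * g]addr0 -yh -mulrDr -mulrA Hg mulr1.
Qed.

Lemma corner_commute : g * t = t * g. Proof. exact: gt. Qed.

Lemma corner_idem : q * q = q.
Proof. by rewrite /q mulrA -[t * g * t]mulrA gt mulrA ttg. Qed.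

Lemma corner_neq0 : q != 0.
Proof.
apply/eqP => q0; have := e_neq0 (F := F) (lexx u); rewrite -(inj_eq phi_inj)
  raddf0.
by rewrite -/t -ttg -mulrA -/q q0 mulr0 eqxx.
Qed.

Lemma corner_orth : e y y * q = 0 /\ q * e y y = 0.
Proof. by rewrite /q mulrA yt mul0r -mulrA gy ty. Qed.

Context (q_domain : corner_domain q).

Let qtq : q * t * q = t.
Proof. by rewrite /q -[t * g * t]mulrA gt [t * (t * g)]mulrA ttg mulrA ttg. Qed.

Let phi_e_neq v w : (v <= w)%O -> (v, w) != (u, u) -> phi (e v w) <> t.
Proof.
move=> vw; rewrite xpair_eqE => nvw /phi_inj/(congr1 (fun f => coef f v w))/eqP.
by rewrite !coef_e // !eqxx (negPf nvw) /= oner_eq0.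
Qed.

(** By the relations, a = phi (e_xu) satisfies the hypotheses of
    [corner_upper].  Of the two possible conclusions, phi (e_xu) = phi (e_u)
    contradicts injectivity, and the other one says that the component of a
    outside e_y A vanishes. *)
Lemma upper_corner : (x <= u)%O -> e y y * phi (e x u) = phi (e x u).
Proof.
move=> lexu; set a := phi (e x u).
have ay : a * e y y = 0 by rewrite off_l ?mul_e_neq.
have aq : a * q = a.
  rewrite /q mulrA -[RHS]mulr1 -Hg mulrA mulrDr ay add0r h_split mulrDr.
  rewrite [a * phi r](pres_mul0 ex pres) ?addr0 ?mul_e_neq //.
  by rewrite !mulrBr mulr1 mul_e_neq // mul_e // eqxx subr0 subrr.
have ra : phi r * a = 0.
  have := pres_mul_upper0 ex pres (mul_e_l lexu) (mul_e_neq lexu (lexx x) ux)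
    ex_eu rx ru.
  by rewrite mul_e // eqxx.
have fqa : (e y y + q) * a = a.
  have Ha : (e y y + h) * a = e y y * a + t * a.
    by rewrite mulrDl h_split [(t + _) * a]mulrDl ra addr0.
  by rewrite -[RHS]mul1r -gH -mulrA Ha mulrDr !mulrA gy gt -mulrDl.
have at_ : a * t = (e y y + a) * a.
  have := pres_mul_upper ex pres (mul_e_l lexu) (mul_e_neq lexu (lexx x) ux)
    ex_eu.
  by rewrite /= phi_ex mul_e // eqxx.
have [yq qy] := corner_orth.
have [at0|qa] := corner_upper ey corner_idem qy q_domain qtq aq fqa at_.
  by case: (@phi_e_neq x u) => //; rewrite xpair_eqE (negPf xu).
by rewrite -{2}fqa mulrDl qa addr0.
Qed.

Lemma lower_corner : (u <= x)%O -> phi (e u x) * e y y = phi (e u x).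
Proof.
move=> leux; set a := phi (e u x).
have xa0 : e x x * e u x = 0 by rewrite mul_e_neq.
have ya : e y y * a = 0 by rewrite off_r.
have qa : q * a = a.
  rewrite /q -gt -mulrA -[RHS]mul1r -gH -mulrA mulrDl ya add0r h_split mulrDl.
  rewrite [phi r * a](pres_mul0 ex pres) ?addr0 //.
  by rewrite !mulrBl mul1r xa0 mul_e // eqxx subr0 subrr.
have ar : a * phi r = 0.
  have := pres_mul_lower0 ex pres (mul_e_r leux) xa0 eu_ex xr ur.
  by rewrite mul_e // eqxx.
have afq : a * (e y y + q) = a.
  have aH : a * (e y y + h) = a * e y y + a * t.
    by rewrite mulrDr h_split [a * (t + _)]mulrDr ar addr0.
  by rewrite -[RHS]mulr1 -Hg mulrA aH mulrDl -!mulrA yg -mulrDr.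
have ta : t * a = a * (e y y + a).
  have := pres_mul_lower ex pres (mul_e_r leux) xa0 eu_ex.
  by rewrite /= phi_ex mul_e // eqxx.
have [yq qy] := corner_orth.
have [at0|aq] := corner_lower ey corner_idem yq q_domain qtq qa afq ta.
  by case: (@phi_e_neq u x) => //; rewrite xpair_eqE (negPf xu) andbF.
by rewrite -{2}afq mulrDr aq addr0.
Qed.

End Corner.

(** The idempotents phi(e_v) g, for v <> x, together with e_y, form a family
    of orthogonal nonzero idempotents indexed by X. *)
Lemma image_corner_domain u : u != x -> corner_domain (phi (e u u) * g).
Proof.
move=> ux; pose q v := if v == x then e y y else phi (e v v) * g.
have q_orth v w : q v * q w = if v == w then q v else 0.
  rewrite /q; have [vx | vx] := eqVneq v x; have [wx | wx] := eqVneq w x.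
  - by rewrite vx wx eqxx ey.
  - by rewrite vx eq_sym (negPf wx); case: (corner_orth wx).
  - by rewrite wx (negPf vx); case: (corner_orth vx).
  have [<- | vw] := eqVneq v w; first exact: corner_idem.
  rewrite mulrA -[_ * g * _]mulrA corner_commute // mulrA.
  by rewrite (pres_mul0 ex pres) ?mul0r // mul_e_neq // eq_sym.
have q_neq0 v : q v != 0.
  by rewrite /q; have [_ | vx] := eqVneq v x; [apply: e_neq0 | apply:
    corner_neq0].
have [s [_ q_diag]] := orth_idem_diag q_orth q_neq0.
have -> : phi (e u u) * g = q u by rewrite /q (negPf ux).
by apply: (corner_domain_idem (s := s u)) => //; rewrite q_orth eqxx.
Qed.

End ImageCorners.

Lemma image_upper u : (x <= u)%O -> e y y * phi (e x u) = phi (e x u).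
Proof.
have [-> | ux] := eqVneq u x; first by rewrite phi_ex ey.
have [g [Hg gH]] := unit_image_invertible phi_bij pres.
by move=> xu; apply: (upper_corner Hg gH ux) => //; apply: image_corner_domain.
Qed.

Lemma image_lower u : (u <= x)%O -> phi (e u x) * e y y = phi (e u x).
Proof.
have [-> | ux] := eqVneq u x; first by rewrite phi_ex ey.
have [g [Hg gH]] := unit_image_invertible phi_bij pres.
by move=> xu; apply: (lower_corner Hg gH ux) => //; apply: image_corner_domain.
Qed.

(** On each Peirce component phi 1 = e_y + h acts in the same way from both
    sides: as the identity on the images of e_x, M and N, and as h on that of
    B. *)
Lemma image1_commute a b : (a <= b)%O ->
  phi 1 * phi (e a b) = phi (e a b) * phi 1.
Proof.
have hx : (1 - e x x) * e x x = 0 by rewrite mulrBl mul1r ex subrr.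
have xh : e x x * (1 - e x x) = 0 by rewrite mulrBr mulr1 ex subrr.
move=> ab; rewrite phi1; have [ax | ax] := eqVneq a x;
  have [bx | bx] := eqVneq b x.
- by rewrite ax bx phi_ex mulrDl mulrDr yh hy.
- rewrite ax in ab *; set m := phi (e x b).
  have ym : e y y * m = m by apply: image_upper.
  have my : m * e y y = 0 by rewrite off_l ?mul_e_neq.
  have mh : m * h = m.
    have := pres_mul_upper ex pres (mul_e_l ab) (mul_e_neq ab (lexx x) bx) xh.
    rewrite /= phi_ex mulrBr mulr1 mul_e_neq // subr0 -/m -/h => ->.
    by rewrite mulrDl ym -{3}ym mulrA my mul0r addr0.
  by rewrite mulrDl mulrDr ym my mh -{2}ym mulrA hy mul0r add0r addr0.
- rewrite bx in ab *; set n := phi (e a x); have xa : x != a by rewrite eq_sym.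
  have ny : n * e y y = n by apply: image_lower.
  have xn : e x x * e a x = 0 by rewrite mul_e_neq.
  have yn : e y y * n = 0 by rewrite off_r.
  have hn : h * n = n.
    have := pres_mul_lower ex pres (mul_e_r ab) xn hx.
    rewrite /= phi_ex mulrBl mul1r xn subr0 -/n -/h => ->.
    by rewrite mulrDr ny -{2}ny -mulrA yn mulr0 addr0.
  by rewrite mulrDl mulrDr ny yn hn -{3}ny -mulrA yh mulr0 add0r addr0.
- move: a b ab ax bx.
  apply: (off_idem_ind
    (P := fun f => (e y y + h) * phi f = phi f * (e y y + h))).
    by move=> f g fH gH; rewrite raddfB mulrBr mulrBl fH gH.
  move=> f ff fx xf; rewrite mulrDl mulrDr off_r // off_l //.
  by have [-> ->] := pres_mul_idem_comm ex pres ff fx xf.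
Qed.

Lemma image1 : phi 1 = 1.
Proof.
have comm f : phi 1 * phi f = phi f * phi 1.
  move: f; apply: incalg_span_ind => [|f g fH gH|c u v uv].
  - by rewrite raddf0 mulr0 mul0r.
  - by rewrite raddfD mulrDl mulrDr fH gH.
  - by rewrite linearZ -incalg_scalerAl -incalg_scalerAr image1_commute.
have [phi' _ phi'K] := phi_bij.
rewrite (@central_coef _ _ _ (phi 1) y X_connected).
  have := congr1 (fun f => coef f y y) (mulrDr (e y y) (e y y) h).
  rewrite -phi1 ey yh addr0 /= coefM_diag coef_e // eqxx mul1r => ->.
  by rewrite scale1r.
by move=> u v _; rewrite -[e u v]phi'K comm.
Qed.

Let hE : h = 1 - e y y.
Proof. by rewrite -image1 phi1 [_ + h]addrC addrK. Qed.

Lemma image_mul_off a b f : (a <= b)%O -> a != x -> b != x -> e x x * f = 0 ->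
  phi (e a b * f) = phi (e a b) * phi f.
Proof.
move=> ab ax bx xf; move: a b ab ax bx.
apply: (off_idem_ind (P := fun g => phi (g * f) = phi g * phi f)) =>
  [g k gf kf|g gg gx xg].
  by rewrite mulrBl linearB gf kf -mulrBl -linearB.
rewrite (pres_mul_idem ex pres gg gx xg xf) /= -/h hE mulrBl mul1r off_r ?subr0
  //.
by rewrite mulrA xg mul0r.
Qed.

(** All products of matrix units except those of N by M.  When exactly one of b
    and c is x, both sides vanish; otherwise one factor is e_x, or
    [image_mul_off] or [pres_mul_upper] applies. *)
Lemma image_mul_e0 a b c w : (a <= b)%O -> (c <= w)%O ->
  [|| a == x, b != x | c != x] ->
  phi (e a b * e c w) = phi (e a b) * phi (e c w).
Proof.
move=> ab cw; have [bx | bx] := eqVneq b x; have [cx | cx] := eqVneq c x.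
- rewrite !orbF bx cx => /eqP ->; rewrite cx in cw.
  by rewrite mul_e // eqxx phi_ex image_upper.
- move=> _; have xc : x != c by rewrite eq_sym.
  rewrite bx mul_e_neq // -?bx // raddf0 bx -image_lower -?bx // bx.
  by rewrite -mulrA off_r ?mulr0 // mul_e_neq.
- move=> _; rewrite cx in cw *.
  by rewrite mul_e_neq // raddf0 -image_upper // mulrA off_l ?mul0r //
    mul_e_neq.
move=> _; have xc : x != c by rewrite eq_sym.
have [ax | ax] := eqVneq a x; last by rewrite image_mul_off // mul_e_neq.
rewrite ax in ab *.
rewrite (pres_mul_upper ex pres (mul_e_l ab) (mul_e_neq ab (lexx x) bx)
  (mul_e_neq _ cw xc)) //=.
rewrite phi_ex mul_e //; case: eqP => [bc | _]; last by rewrite raddf0 mulr0.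
have xw : (x <= w)%O by rewrite (le_trans ab) // bc.
rewrite mulrDl image_upper // -[X in _ + _ * X]image_upper // mulrA off_l
  ?mul_e_neq //.
by rewrite mul0r addr0.
Qed.

(** The remaining products.  The factorization of e_x that sees e_ux e_xv is
    e_x = (e_x + e_xv - e_ux + e_u)(e_x + e_ux - e_xv + e_v - e_uv).
    After phi, every term of its expansion but one is known by
    [image_mul_e0]. *)
Lemma image_lower_upper u v : (u <= x)%O -> (x <= v)%O -> u != x -> v != x ->
  phi (e u x) * phi (e x v) = phi (e u v).
Proof.
move=> ux xv uDx vDx; have uv := le_trans ux xv.
have xDu : x != u by rewrite eq_sym.
have xDv : x != v by rewrite eq_sym.
have vDu : v != u.
  by apply: contra uDx => /eqP vu; rewrite eq_le ux -vu xv.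
have uDv : u != v by rewrite eq_sym.
pose c := e u x - e x v + (e v v - e u v).
have cE f : f * c = f * e u x - f * e x v + (f * e v v - f * e u v).
  by rewrite /c mulrDr !mulrBr.
have xc : e x x * c = - e x v.
  by rewrite cE !mul_e // eqxx (negPf xDu) (negPf xDv) subr0 addr0 sub0r.
have xvc : e x v * c = e x v.
  rewrite cE !mul_e // eqxx (negPf vDu) (negPf vDx).
  by rewrite !subr0 add0r.
have uxc : e u x * c = - e u v.
  by rewrite cE !mul_e // eqxx (negPf xDu) (negPf xDv) subr0 addr0 sub0r.
have uuc : e u u * c = e u x - e u v.
  by rewrite cE !mul_e // eqxx (negPf uDx) (negPf uDv) subr0 sub0r.
have phi_cE (k : A) : k * phi c =
    k * phi (e u x) - k * phi (e x v) + (k * phi (e v v) - k * phi (e u v)).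
  by rewrite /c linearD !linearB mulrDr !mulrBr.
have yc : e y y * phi c = - phi (e x v).
  rewrite phi_cE image_upper // !off_r ?mul_e_neq //.
  by rewrite oppr0 !addr0 add0r.
have phi_xvc : phi (e x v) * phi c = phi (e x v).
  rewrite phi_cE -!image_mul_e0 ?eqxx // !mul_e // eqxx (negPf vDu) (negPf vDx).
  by rewrite !linear0 !addr0 add0r.
have phi_uxc : phi (e u x) * phi c = - (phi (e u x) * phi (e x v)).
  rewrite phi_cE -[phi (e u x) * phi (e u x)]image_mul_e0
    -?[phi (e u x) * phi (e v v)]image_mul_e0
    -?[phi (e u x) * phi (e u v)]image_mul_e0 ?uDx ?vDx ?orbT //.
  rewrite !mul_e // (negPf xDu) (negPf xDv).
  by rewrite !linear0 !addr0 add0r.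
have phi_uuc : phi (e u u) * phi c = phi (e u x) - phi (e u v).
  rewrite phi_cE -!image_mul_e0 ?uDx ?orbT // !mul_e // eqxx (negPf uDx) (negPf
    uDv).
  by rewrite !linear0 !addr0 add0r.
have := @pres_perturb _ _ _ _ _ ex pres (e x v - e u x + e u u) c.
rewrite !mulrDl !mulNr xc xvc uxc uuc mul_e_neq // mul_e_r // mul_e_neq //
  sub0r addr0 opprK.
rewrite addrACA !addKr subrr => /(_ erefl).
rewrite /= phi_ex yc linearD linearB !mulrDl !mulNr phi_xvc phi_uxc phi_uuc.
rewrite off_l ?mul_e_neq // image_lower // off_l ?mul_e_neq // sub0r addr0
  opprK.
by rewrite addrACA !addKr => /eqP; rewrite subr_eq0 => /eqP.
Qed.

Lemma image_mul f g : phi (f * g) = phi f * phi g.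
Proof.
have mul_e_e a b c w : (a <= b)%O -> (c <= w)%O ->
    phi (e a b * e c w) = phi (e a b) * phi (e c w).
  move=> ab cw; have [|] := boolP [|| a == x, b != x | c != x].
    exact: image_mul_e0.
  rewrite !negb_or !negbK => /and3P[ax /eqP bx /eqP cx].
  rewrite bx in ab *; rewrite cx in cw *; rewrite mul_e // eqxx.
  have [-> | wx] := eqVneq w x; first by rewrite phi_ex image_lower.
  by rewrite image_lower_upper.
move: f; apply: incalg_span_ind => [|f f' IHf IHf'|k a b ab].
- by rewrite mul0r linear0 mul0r.
- by rewrite mulrDl !linearD mulrDl IHf IHf'.
move: g; apply: incalg_span_ind => [|g g' IHg IHg'|l c w cw].
- by rewrite mulr0 linear0 mulr0.
- by rewrite mulrDr !linearD mulrDr IHg IHg'.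
rewrite -incalg_scalerAl -incalg_scalerAr !linearZ mul_e_e //.
by rewrite -incalg_scalerAl -incalg_scalerAr.
Qed.

End MatrixUnitsNormalized.

(** * Automorphisms of the algebra and of the poset *)

Section Automorphisms.
Context {F : fieldType} {d : Order.disp_t} {X : finPOrderType d}.
Local Notation A := (incalg F X).
Local Notation e := (e_ F).
Implicit Types (f g : A) (u v z : X).

Lemma alg_automorphism_comp (psi1 psi2 : A -> A) :
  alg_automorphism psi1 -> alg_automorphism psi2 ->
  alg_automorphism (psi1 \o psi2).
Proof.
move=> [l1 [m1 n1] b1] [l2 [m2 n2] b2]; split; last exact: bij_comp.
  by move=> a f g /=; rewrite l2 l1.
by split=> [|f g] /=; rewrite ?m2 ?m1 // n2 n1.
Qed.

Definition conj_by (c c' : A) f : A := c * f * c'.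

Lemma conj_byK c c' : c * c' = 1 -> c' * c = 1 ->
  cancel (conj_by c c') (conj_by c' c).
Proof.
by move=> cc' c'c f; rewrite /conj_by !mulrA c'c mul1r -mulrA c'c mulr1.
Qed.

Lemma alg_automorphism_conj c c' : c * c' = 1 -> c' * c = 1 ->
  alg_automorphism (conj_by c c').
Proof.
move=> cc' c'c; split.
- move=> a f g; rewrite /conj_by mulrDr mulrDl.
  by rewrite -incalg_scalerAr -incalg_scalerAl.
- split=> [|f g]; first by rewrite /conj_by mulr1.
  by rewrite /conj_by !mulrA -[_ * c' * c]mulrA c'c mulr1.
by exists (conj_by c' c); apply: conj_byK.
Qed.

Lemma alg_automorphism_pres psi f : alg_automorphism psi ->
  preserves_products_equal_to psi f (psi f).
Proof. by move=> [_ [_ psiM] _] a b <-; rewrite psiM. Qed.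

Lemma prim_idem_conj epsilon u : primitive_idempotent epsilon ->
  diag_part epsilon = e u u ->
  exists c c', [/\ c * c' = 1, c' * c = 1 & epsilon = conj_by c c' (e u u)].
Proof.
move=> [ee _] ediag; apply: idem_conj_e => // z.
have := coef_diag_part epsilon z z.
by rewrite ediag coef_e // andbb eqxx mulr1.
Qed.

(** The induced injection of X * X maps the finite order relation into, hence
    onto, itself. *)
Lemma order_automorphism_mono (s : X -> X) : order_automorphism s ->
  {mono s : u v / (u <= v)%O}.
Proof.
move=> [s_bij s_homo]; pose E := [set p : X * X | (p.1 <= p.2)%O].
pose ss p := (s p.1, s p.2).
have ss_inj : injective ss.
  by move=> [a b] [a' b'] [/(bij_inj s_bij) -> /(bij_inj s_bij) ->].
have /eqP ssE : ss @: E == E.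
  rewrite eqEcard card_imset // leqnn andbT; apply/subsetP => _ /imsetP[p pE
    ->].
  by rewrite inE in pE; rewrite inE s_homo.
move=> u v; apply/idP/idP => [suv | /s_homo //].
have : (s u, s v) \in ss @: E by rewrite ssE inE.
case/imsetP => -[a b]; rewrite inE /= => ab [].
by move=> /(bij_inj s_bij) -> /(bij_inj s_bij) ->.
Qed.

Section Transport.
Context (s s' : X -> X) (s'K : cancel s' s).
Context (s_mono : {mono s : u v / (u <= v)%O}).

Lemma transport_subproof f :
  [ffun p : X * X => coef f (s' p.1) (s' p.2) : F^o] \in @incident F d X.
Proof.
apply/incidentP => u v nuv; rewrite ffunE coef_eq0 //=.
by rewrite -s_mono !s'K.
Qed.

Definition transport f : A := IncAlg (transport_subproof f).

Lemma coef_transport f u v : coef (transport f) u v = coef f (s' u) (s' v).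
Proof. by rewrite {1}/coef /= ffunE. Qed.
End Transport.

Lemma order_automorphism_alg (s : X -> X) : order_automorphism s ->
  exists2 psi : A -> A, alg_automorphism psi &
    forall u, psi (e u u) = e (s u) (s u).
Proof.
move=> s_aut; have s_mono := order_automorphism_mono s_aut.
have [s' sK s'K] := s_aut.1.
have s'_mono : {mono s' : u v / (u <= v)%O} by move=> u v; rewrite -s_mono !s'K.
exists (transport s'K s_mono).
  split.
  - by move=> a f g; apply/incalgP => u v; rewrite !(coef_transport,
    Defs.coefD, Defs.coefZ).
  - split=> [|f g]; apply/incalgP => u v; rewrite !coef_transport.
      by rewrite !coef1E (inj_eq (can_inj s'K)).
    rewrite !Defs.coefM (reindex s') /=; last by exists s => w _.
    by apply: eq_bigr => w _; rewrite !coef_transport.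
  by exists (transport sK s'_mono) => f; apply/incalgP => u v;
    rewrite !coef_transport ?sK ?s'K.
move=> u; apply/incalgP => a b; rewrite coef_transport !coef_e //.
by rewrite !(can2_eq s'K sK).
Qed.

(** The position of the 1 on the diagonal of psi (e_u) defines s u. If
    s u <= s v failed, psi (e_u) A psi (e_v), which is e_(s u) A e_(s v) up to units on
    both sides, would be 0, while it contains psi (e_uv). *)
Lemma alg_automorphism_order (psi : A -> A) (x y : X) :
  alg_automorphism psi -> psi (e x x) = e y y ->
  exists s : X -> X, order_automorphism s /\ s x = y.
Proof.
move=> [psi_lin [psi1 psiM] psi_bij] psi_x.
have psi0 : psi 0 = 0.
  by have := psi_lin (-1) 0 0; rewrite scaler0 addr0 scaleN1r addNr.
have psi_neq0 f : f != 0 -> psi f != 0.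
  by apply: contra => /eqP f0; rewrite -(inj_eq (bij_inj psi_bij)) f0 psi0.
have q_orth u v : psi (e u u) * psi (e v v) = if u == v then psi (e u u) else 0.
  by rewrite -psiM mul_e //; case: eqP => [->|_].
have [u|s [s_bij s_diag]] := orth_idem_diag q_orth.
  by rewrite psi_neq0 ?e_neq0.
exists s; split; last first.
  have := s_diag x y; rewrite psi_x coef_e // eqxx.
  by case: eqP => // _ /eqP; rewrite oner_eq0.
split=> // u v uv; apply: contraT => nsuv.
have idem w : psi (e w w) * psi (e w w) = psi (e w w) by rewrite q_orth eqxx.
have [c [c' [_ _ uE]]] := idem_conj_e (idem u) (s_diag u).
have [b [b' [_ _ vE]]] := idem_conj_e (idem v) (s_diag v).
have : psi (e u u * e u v * e v v) = 0.
  rewrite !psiM uE vE.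
  have -> : c * e (s u) (s u) * c' * psi (e u v) * (b * e (s v) (s v) * b') =
      c * (e (s u) (s u) * (c' * psi (e u v) * b) * e (s v) (s v)) * b'.
    by rewrite !mulrA.
  by rewrite e_mul_mul_e coef_eq0 // scale0r mulr0 mul0r.
rewrite mul_e // eqxx mul_e // eqxx => /eqP.
by have := psi_neq0 _ (e_neq0 uv); rewrite -/(_ == 0) => /negPf ->.
Qed.

Lemma pres_matrix_units_pm (phi : {linear A -> A}) (x y : X) :
  connected_poset X -> bijective phi ->
  preserves_products_equal_to phi (e x x) (e y y) ->
  exists psi : A -> A, [/\ alg_automorphism psi, psi (e x x) = e y y &
    phi =1 psi \/ phi =1 (fun f => - psi f)].
Proof.
move=> X_conn.
have norm (chi : {linear A -> A}) : bijective chi ->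
    preserves_products_equal_to chi (e x x) (e y y) -> chi (e x x) = e y y ->
    alg_automorphism chi.
  move=> chi_bij chi_pres chi_x; split=> //; first exact: linearP.
  split; first exact: image1 chi_x.
  by move=> f g; apply: image_mul chi_x _ _.
move=> phi_bij phi_pres; have [phi_x | phi_x] := image_e_pm phi_bij phi_pres.
  by exists phi; split=> //; [apply: norm | left].
pose chi : {linear A -> A} := \- phi; exists chi; split.
- apply: norm => //; last by rewrite /chi /= phi_x opprK.
    case: phi_bij => phi' phiK phi'K; exists (fun f => phi' (- f)) => f.
      by rewrite /chi /= opprK phiK.
    by rewrite /chi /= phi'K opprK.
  by move=> f g fg; rewrite /chi /= mulrNN; apply: phi_pres.
- by rewrite /chi /= phi_x opprK.
- by right=> f; rewrite /chi /= opprK.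
Qed.

End Automorphisms.

Theorem theorem3p17 (F : fieldType) (d : Order.disp_t) (X : finPOrderType d)
    (X_connected : connected_poset X) (x y : X)
    (epsilon eta : incalg F X)
    (epsilon_prim : primitive_idempotent epsilon)
    (eta_prim : primitive_idempotent eta)
    (epsilon_diag : diag_part epsilon = e_ F x x)
    (eta_diag : diag_part eta = e_ F y y) :
  ((exists phi : {linear incalg F X -> incalg F X},
       bijective phi /\ preserves_products_equal_to phi epsilon eta)
   <->
   (exists s : X -> X, order_automorphism s /\ s x = y))
  /\
  (forall phi : {linear incalg F X -> incalg F X},
     bijective phi -> preserves_products_equal_to phi epsilon eta ->
     alg_automorphism phi \/
     exists psi : incalg F X -> incalg F X,
       alg_automorphism psi /\ phi =1 (fun f => - psi f)).
Proof.
have [c [c' [cc' c'c epsE]]] := prim_idem_conj epsilon_prim epsilon_diag.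
have [b [b' [bb' b'b etaE]]] := prim_idem_conj eta_prim eta_diag.
have c_aut := alg_automorphism_conj cc' c'c.
have c'_aut := alg_automorphism_conj c'c cc'.
have b_aut := alg_automorphism_conj bb' b'b.
have b'_aut := alg_automorphism_conj b'b bb'.
have key (phi : {linear incalg F X -> incalg F X}) :
    bijective phi -> preserves_products_equal_to phi epsilon eta ->
    exists psi : incalg F X -> incalg F X,
      [/\ alg_automorphism psi, psi (e_ F x x) = e_ F y y &
          phi =1 conj_by b b' \o psi \o conj_by c' c \/
          phi =1 (fun f => - (conj_by b b' \o psi \o conj_by c' c) f)].
  move=> phi_bij phi_pres; pose chi0 := conj_by b' b \o phi \o conj_by c c'.
  have chi_lin : linear chi0.
    case: c_aut => c_lin _ _; case: b'_aut => b_lin _ _ k f g.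
    by rewrite /chi0 /= c_lin linearP b_lin.
  pose chi : {linear incalg F X -> incalg F X} :=
    HB.pack_for {linear incalg F X -> incalg F X} chi0
      (GRing.isLinear.Build F _ _ _ chi0 chi_lin).
  have chi_pres : preserves_products_equal_to chi (e_ F x x) (e_ F y y).
    move=> f g fg; case: b'_aut => _ [_ b'M] _; rewrite -b'M.
    rewrite (phi_pres (conj_by c c' f) (conj_by c c' g)).
      by rewrite etaE conj_byK.
    by case: c_aut => _ [_ cM] _; rewrite -cM fg epsE.
  have chi_bij : bijective chi.
    by case: c_aut b'_aut => [_ _ ?] [_ _ ?]; do 2?apply: bij_comp.
  have [psi [psi_aut psi_x phi_psi]] :=
    pres_matrix_units_pm X_connected chi_bij chi_pres.
  have phiE f : phi f = conj_by b b' (chi (conj_by c' c f)).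
    by rewrite /chi /= /chi0 /= !conj_byK.
  exists psi; split=> //; case: phi_psi => chiE; [left | right] => f.
    by rewrite phiE chiE.
  by rewrite phiE chiE /= /conj_by mulrN mulNr.
have conj_aut psi : alg_automorphism psi ->
    alg_automorphism (conj_by b b' \o psi \o conj_by c' c).
  by move=> psi_aut; do 2?apply: alg_automorphism_comp.
split.
  split=> [[phi [phi_bij phi_pres]] | [s [s_aut sx]]].
    have [psi [psi_aut psi_x _]] := key phi phi_bij phi_pres.
    exact: alg_automorphism_order psi_aut psi_x.
  have [psi psi_aut psi_e] := order_automorphism_alg (F := F) s_aut.
  have := conj_aut psi psi_aut; set chi0 := _ \o _ => chi_aut.
  have [chi_lin _ chi_bij] := chi_aut.
  exists (HB.pack_for {linear incalg F X -> incalg F X} chi0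
      (GRing.isLinear.Build F _ _ _ chi0 chi_lin)); split=> //.
  have <- : chi0 epsilon = eta.
    by rewrite /chi0 /= epsE conj_byK // psi_e sx etaE.
  exact: alg_automorphism_pres.
move=> phi phi_bij phi_pres.
have [psi [psi_aut _ [phiE | phiE]]] := key phi phi_bij phi_pres;
  [left | right].
  have [psi_lin psi_mul psi_bij] := conj_aut psi psi_aut; split.
  - exact: linearP.
  - by case: psi_mul => m1 mM; split=> [|f g]; rewrite !phiE.
  - exact: eq_bij psi_bij _ (fsym phiE).
by exists (conj_by b b' \o psi \o conj_by c' c); split=> //; apply: conj_aut.
Qed.
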